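(* Let $a,b$ be non-zero real numbers, let $(J_n)_{n\ge 0}$ be the bi-periodic Jacobsthal matrix sequence and $(j_n)_{n\ge -1}$ the bi-periodic Jacobsthal sequence associated with $a,b$. Then for every integer $n\ge 0$, $$J_n=\begin{pmatrix} \left(\frac{b}{a}\right)^{\varepsilon(n)} j_{n+1} & 2\frac{b}{a}\, j_n\\[2pt] j_n & 2\left(\frac{b}{a}\right)^{\varepsilon(n)} j_{n-1}\end{pmatrix}.$$
   Context: Fix non-zero real numbers $a,b$. The parity function is $\varepsilon(n)=0$ if $n$ is even and $\varepsilon(n)=1$ if $n$ is odd. The bi-periodic Jacobsthal matrix sequence $(J_n)_{n\ge 0}$ of $2\times 2$ real matrices is defined by $J_0=\begin{pmatrix}1&0\\0&1\end{pmatrix}$, $J_1=\begin{pmatrix} b & 2\frac{b}{a}\\ 1&0\end{pmatrix}$, and for $n\ge 2$: $J_n=aJ_{n-1}+2J_{n-2}$ if $n$ is even, $J_n=bJ_{n-1}+2J_{n-2}$ if $n$ is odd. The (scalar) bi-periodic Jacobsthal sequence is defined by $j_0=0$, $j_1=1$, and for $n\ge 2$: $j_n=aj_{n-1}+2j_{n-2}$ if $n$ is even, $j_n=bj_{n-1}+2j_{n-2}$ if $n$ is odd. By convention $j_{-1}=\frac12$. *)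

(* Defs.v *)
From HB Require Import structures.
From mathcomp Require Import all_boot all_order all_algebra.
From mathcomp Require Import reals.

Set Implicit Arguments.
Unset Strict Implicit.
Unset Printing Implicit Defensive.

Import Order.TTheory GRing.Theory Num.Theory.
Local Open Scope ring_scope.

Definition parity (n : nat) : nat := if odd n then 1%N else 0%N.

Definition mx22 (R : realType) (x y z t : R) : 'M[R]_2 :=
  \matrix_(i < 2, j < 2)
    if i == 0 then (if j == 0 then x else y) else (if j == 0 then z else t).

Fixpoint jacobsthal_mx (R : realType) (a b : R) (n : nat) {struct n} : 'M[R]_2 :=
  match n with
  | 0%N => mx22 1 0 0 1
  | 1%N => mx22 b (2 * (b / a)) 1 0
  | (m.+1 as k).+1 =>
      (if odd n then b else a) *: jacobsthal_mx a b k
        + 2 *: jacobsthal_mx a b m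
  end.

Fixpoint jacobsthal_nat (R : realType) (a b : R) (n : nat) {struct n} : R :=
  match n with
  | 0%N => 0
  | 1%N => 1
  | (m.+1 as k).+1 =>
      (if odd n then b else a) * jacobsthal_nat a b k
        + 2 * jacobsthal_nat a b m
  end.

(* The scalar sequence is only meaningful for indices n >= -1, with
   j_(-1) = 1/2 by convention; the value 0 for n < -1 is a dummy.
   Recall that Negz k is the integer - (k + 1). *)
Definition jacobsthal (R : realType) (a b : R) (n : int) : R :=
  match n with
  | Posz m => jacobsthal_nat a b m
  | Negz 0 => 2^-1
  | Negz _ => 0
  end.

(* Main.v *)
Require Import Defs.
From HB Require Import structures.
From mathcomp Require Import all_boot all_order all_algebra.
From mathcomp Require Import reals.
From mathcomp Require Import ring.

Set Implicit Arguments.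
Unset Strict Implicit.
Unset Printing Implicit Defensive.

Import Order.TTheory GRing.Theory Num.Theory.
Local Open Scope ring_scope.

(** Strong induction: both sides obey the same two-term recurrence, entry by entry. The off-diagonal
    entries do so directly. The diagonal ones involve [j] at indices of the opposite parity, whose
    recurrence uses the other of [a], [b]; the factor [(b / a) ^+ parity n] corrects this swap,
    since [a * (b / a) = b]. *)

Lemma add_scale_mx22 (R : realType) (c d x y z t x' y' z' t' : R) :
  c *: mx22 x y z t + d *: mx22 x' y' z' t' =
    mx22 (c * x + d * x') (c * y + d * y') (c * z + d * z') (c * t + d * t').
Proof. by apply/matrixP => i j; rewrite !mxE; case: (i == 0); case: (j == 0). Qed.

(* The convention j_(-1) = 1/2 is what makes this hold at n = 0. *)
Lemma jacobsthal_rec (R : realType) (a b : R) (n : nat) :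
  jacobsthal a b (n%:Z + 1) =
    (if odd n then a else b) * jacobsthal a b n%:Z
      + 2 * jacobsthal a b (n%:Z - 1).
Proof.
case: n => [|n]; first by rewrite /= mulr0 add0r divff ?pnatr_eq0.
have -> : n.+1%:Z - 1 = n%:Z by rewrite -addn1 PoszD addrK.
by rewrite -PoszD addn1 /=; case: (odd n).
Qed.

Theorem theorem2 (R : realType) (a b : R) (ha : a != 0) (hb : b != 0) (n : nat) :
  jacobsthal_mx a b n =
    mx22 ((b / a) ^+ parity n * jacobsthal a b (n%:Z + 1))
         (2 * (b / a) * jacobsthal a b n%:Z)
         (jacobsthal a b n%:Z)
         (2 * (b / a) ^+ parity n * jacobsthal a b (n%:Z - 1)).
Proof.
elim/ltn_ind: n => -[|[|n]] IH.
- by rewrite /= !(mul1r, mulr1, mulr0) divff ?pnatr_eq0.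
(* Here [j_2 = a], so the top-left entry is [(b / a) * a = b]. *)
- by rewrite /= !(mulr0, addr0, mulr1) divfK.
have -> : jacobsthal_mx a b n.+2 =
    (if odd n then b else a) *: jacobsthal_mx a b n.+1
      + 2 *: jacobsthal_mx a b n by rewrite /= negbK.
rewrite !IH // add_scale_mx22.
have e1 : n.+1%:Z = n%:Z + 1 by rewrite -addn1 PoszD.
have e2 : n.+2%:Z = n.+1%:Z + 1 by rewrite -PoszD addn1.
have r0 := jacobsthal_rec a b n.
have r1 := jacobsthal_rec a b n.+1.
have r2 := jacobsthal_rec a b n.+2.
(* Unfolding [j] from index [n + 3] down leaves only [j_n] and [j_(n-1)]. Each entry is then, for
   either parity of [n], an identity of rational functions with denominator a power of [a]. *)
rewrite e2 addrK in r2 *; rewrite r2 r1 e1 addrK r0 /parity /=.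
by case: (odd n) => /=; congr mx22; field.
Qed.
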